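(* Let $S_1,S_2\in\mathbb{R}^{d\times d}$ be skew-symmetric, $L_1,L_2\in\mathbb{R}^{d\times d}$ symmetric, $U:\mathbb{R}^d\times\mathbb{R}^d\to\mathbb{R}$ continuously differentiable, and $\tau>0$. Let $$H(p,q)=\tfrac12 p^\top L_1p+\tfrac12 q^\top L_2q+U(p,q).$$ The EPAVF method and its adjoint (both defined in the context) preserve the discrete Hamiltonian energy: if $(p^n,q^n)$ and $(p^{n+1},q^{n+1})$ in $\mathbb{R}^d\times\mathbb{R}^d$ satisfy the equations of the EPAVF method with step size $\tau$, or if they satisfy the equations of its adjoint method with step size $\tau$, then $$H(p^{n+1},q^{n+1})=H(p^n,q^n).$$
   Context: The underlying Hamiltonian system is $\dot p=S_1(L_1p+\nabla_pU(p,q))$, $\dot q=S_2(L_2q+\nabla_qU(p,q))$, with $p,q\in\mathbb{R}^d$. Put $V_i=\tau S_iL_i$ for $i=1,2$, and for a square matrix $V$ let $\varphi(V)=\int_0^1\exp((1-\xi)V)\,d\xi$. The EPAVF (exponential partitioned averaged vector field) method is the (implicit) one-step method $(p^n,q^n)\mapsto(p^{n+1},q^{n+1})$ given by $$p^{n+1}=\exp(V_1)p^n+\tau\varphi(V_1)S_1\int_0^1\nabla_pU(\xi p^{n+1}+(1-\xi)p^n,\,q^n)\,d\xi,$$ $$q^{n+1}=\exp(V_2)q^n+\tau\varphi(V_2)S_2\int_0^1\nabla_qU(p^{n+1},\,\xi q^{n+1}+(1-\xi)q^n)\,d\xi.$$ Its adjoint method is $$p^{n+1}=\exp(V_1)p^n+\tau\varphi(V_1)S_1\int_0^1\nabla_pU(\xi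 p^{n+1}+(1-\xi)p^n,\,q^{n+1})\,d\xi,$$ $$q^{n+1}=\exp(V_2)q^n+\tau\varphi(V_2)S_2\int_0^1\nabla_qU(p^n,\,\xi q^{n+1}+(1-\xi)q^n)\,d\xi.$$ *)

(* Defs.v *)
From mathcomp Require Import all_boot all_order all_algebra.
From mathcomp Require Import all_classical all_reals all_analysis.

Set Implicit Arguments.
Unset Strict Implicit.
Unset Printing Implicit Defensive.

Import Order.TTheory GRing.Theory Num.Theory.
Import numFieldNormedType.Exports.

Local Open Scope classical_set_scope.
Local Open Scope ring_scope.

Section MatrixCalculus.
Context {R : realType}.

Definition expmx (d : nat) (V : 'M[R]_d) : 'M[R]_d :=
  lim (series (fun k : nat => (k`!%:R)^-1 *: V ^+ k) @ \oo).

(* Entrywise Lebesgue integral over [0, 1]; it is used on continuous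
   integrands only, where it is the Riemann integral. *)
Definition mxint01 (m n : nat) (F : R -> 'M[R]_(m, n)) : 'M[R]_(m, n) :=
  \matrix_(i, j) (\int[lebesgue_measure]_(xi in `[0, 1]) F xi i j).

Definition phimx (d : nat) (V : 'M[R]_d) : 'M[R]_d :=
  mxint01 (fun xi => expmx ((1 - xi) *: V)).

Definition grad (d : nat) (f : 'cV[R]_d -> R) (x : 'cV[R]_d) : 'cV[R]_d :=
  \col_i 'D_(delta_mx i 0) f x.

Definition gradp (d : nat) (U : 'cV[R]_d * 'cV[R]_d -> R)
    (p q : 'cV[R]_d) : 'cV[R]_d :=
  grad (fun x => U (x, q)) p.

Definition gradq (d : nat) (U : 'cV[R]_d * 'cV[R]_d -> R)
    (p q : 'cV[R]_d) : 'cV[R]_d :=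
  grad (fun y => U (p, y)) q.

(* Continuity of the derivative is continuity of both partial gradients
   jointly in (p, q). *)
Definition continuously_differentiable (d : nat)
    (U : 'cV[R]_d * 'cV[R]_d -> R) : Prop :=
  [/\ forall z, differentiable U z,
      continuous (fun z => gradp U z.1 z.2)
    & continuous (fun z => gradq U z.1 z.2)].

End MatrixCalculus.

Section EPAVF.
Context {R : realType} {d : nat}.
Variables (S1 S2 L1 L2 : 'M[R]_d) (U : 'cV[R]_d * 'cV[R]_d -> R) (tau : R).

Definition hamiltonian (p q : 'cV[R]_d) : R :=
  2^-1 * (p^T *m L1 *m p) 0 0 + 2^-1 * (q^T *m L2 *m q) 0 0 + U (p, q).

Let V1 := tau *: (S1 *m L1).
Let V2 := tau *: (S2 *m L2).

Definition EPAVF_step (p0 q0 p1 q1 : 'cV[R]_d) : Prop :=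
  p1 = expmx V1 *m p0 + tau *: (phimx V1 *m S1 *m
         mxint01 (fun xi => gradp U (xi *: p1 + (1 - xi) *: p0) q0)) /\
  q1 = expmx V2 *m q0 + tau *: (phimx V2 *m S2 *m
         mxint01 (fun xi => gradq U p1 (xi *: q1 + (1 - xi) *: q0))).

Definition EPAVF_adjoint_step (p0 q0 p1 q1 : 'cV[R]_d) : Prop :=
  p1 = expmx V1 *m p0 + tau *: (phimx V1 *m S1 *m
         mxint01 (fun xi => gradp U (xi *: p1 + (1 - xi) *: p0) q1)) /\
  q1 = expmx V2 *m q0 + tau *: (phimx V2 *m S2 *m
         mxint01 (fun xi => gradq U p0 (xi *: q1 + (1 - xi) *: q0))).

End EPAVF.

(* Main.v *)
(* Let V = tau S L, A = phi(V) S and w = L p0 + g, where g is the averaged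
   gradient. Since exp(V) = 1 + phi(V) V, one substep reads
   p1 - p0 = tau A w. Skewness of S and symmetry of L give
   A^T = - phi(-V) S; with V phi(V) = exp(V) - 1 and
   phi(-V) exp(V) = phi(V) this yields A + A^T + tau A^T L A = 0. Hence the
   quadratic energy changes by exactly -(p1 - p0)^T g over the substep, while
   U changes by (p1 - p0)^T g by the gradient theorem along the segment
   [p0, p1]. In both methods the two substeps freeze the other variable of U
   in such a way that the two increments of U telescope. *)

Require Import Defs.
From mathcomp Require Import all_boot all_order all_algebra.
From mathcomp Require Import ring lra.
From mathcomp Require Import all_classical all_reals all_analysis.
Import Order.TTheory GRing.Theory Num.Theory.
Import numFieldNormedType.Exports.
Local Open Scope classical_set_scope.
Local Open Scope ring_scope.

(** * Exponential generating functions of sequences of at most geometric growth *)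

Section ExponentialGeneratingFunction.
Context {R : realType}.
Implicit Types (a b : R ^nat) (x : R).

(** This growth condition makes the series of a(k) x^k / k! converge for every x, and it survives
    shifts, hence repeated differentiation. *)
Definition exp_bounded a :=
  exists B C : R, 0 <= C /\ forall k, `|a k| <= B * C ^+ k.

Definition egf_coef a : R ^nat := fun k => k`!%:R^-1 * a k.

Definition egf a x : R := limn (pseries (egf_coef a) x).

Lemma exp_boundedS {a} : exp_bounded a -> exp_bounded (fun k => a k.+1).
Proof.
move=> [B [C [C0 aBC]]]; exists (B * C), C; split=> // k.
by rewrite (le_trans (aBC _))// exprS mulrA.
Qed.

(** Comparison with B times the exponential series at C|x| gives absolute convergence. *)
Lemma is_cvg_egf {a} x : exp_bounded a -> cvgn (pseries (egf_coef a) x).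
Proof.
move=> [B [C [C0 aBC]]]; apply: normed_cvg.
have B0 : 0 <= B by have := aBC 0%N; rewrite expr0 mulr1; apply: le_trans.
apply: (@series_le_cvg _ _ (fun k => B * exp_coeff (C * `|x|) k)).
- by move=> k /=.
- by move=> k; rewrite mulr_ge0// exp_coeff_ge0// mulr_ge0.
- move=> k; rewrite /egf_coef /exp_coeff /= !normrM normfV normr_nat normrX.
  rewrite -mulrA mulrC exprMn !mulrA ler_pM2r ?invr_gt0 ?ltr0n ?fact_gt0//.
  by rewrite ler_wpM2r ?exprn_ge0.
- apply: (@is_cvg_seriesZ _ _ B); exact: is_cvg_series_exp_coeff.
Qed.

Lemma pseries_diffs_egf a :
  pseries_diffs (egf_coef a) = egf_coef (fun k => a k.+1).
Proof.
apply/funext => k; rewrite /pseries_diffs /egf_coef factS natrM invfM.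
by rewrite mulrA mulrA divff ?mul1r ?pnatr_eq0.
Qed.

(** In the termwise derivative the factor k+1 cancels against (k+1)!, so differentiating amounts to
    shifting the sequence. *)
Lemma is_derive_egf {a} x : exp_bounded a ->
  is_derive x 1 (egf a) (egf (fun k => a k.+1) x).
Proof.
move=> ba; rewrite /egf -pseries_diffs_egf.
(* The radius is a point strictly beyond |x| where the series and its first two formal derivatives
   converge. *)
apply: (@pseries_snd_diffs _ _ (`|x| + 1) x); rewrite ?pseries_diffs_egf.
- exact: is_cvg_egf.
- exact: (is_cvg_egf _ (exp_boundedS ba)).
- exact: (is_cvg_egf _ (exp_boundedS (exp_boundedS ba))).
- by rewrite [ltRHS]ger0_norm ?addr_ge0// ltrDl.
Qed.

Lemma egf0 a : egf a 0 = a 0%N.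
Proof.
apply: lim_near_cst => //; near=> n.
(* The empty partial sum is 0; from n = 1 on, each partial sum equals the term of index 0. *)
have -> : n = n.-1.+1 by rewrite prednK//; near: n; exists 1%N.
rewrite /pseries /series /= big_nat_recl// big1 ?addr0 /egf_coef ?fact0.
  by rewrite invr1 mul1r mulr1.
by move=> i _; rewrite exprS mul0r mulr0.
Unshelve. all: by end_near. Qed.

Lemma egfZ {a} (c : R) x : exp_bounded a ->
  egf (fun k => c * a k) x = c * egf a x.
Proof.
move=> /(is_cvg_egf x) ca; rewrite -[RHS]lim_seriesZ//; congr (limn (series _)).
by apply/funext => k; rewrite /egf_coef /= !fctE /GRing.scale/=; rewrite !mulrA (mulrC c).
Qed.

Lemma exp_boundedZ {a} (c : R) : exp_bounded a -> exp_bounded (fun k => c * a k).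
Proof.
move=> [B [C [C0 aBC]]]; exists (`|c| * B), C; split=> // k.
by rewrite normrM -mulrA ler_wpM2l.
Qed.

Lemma egf_sum n {a_ : 'I_n -> R ^nat} x : (forall i, exp_bounded (a_ i)) ->
  egf (fun k => \sum_(i < n) a_ i k) x = \sum_(i < n) egf (a_ i) x.
Proof.
move=> ba; apply/cvg_lim => //.
have -> : pseries (egf_coef (fun k => \sum_(i < n) a_ i k)) x =
    (fun k => \sum_(i < n) pseries (egf_coef (a_ i)) x k).
  apply/funext => N; rewrite /pseries /series /= exchange_big/=.
  by apply: eq_bigr => k _; rewrite /egf_coef mulr_sumr mulr_suml.
by apply: cvg_big => [|i _]; [exact: add_continuous|exact: is_cvg_egf].
Qed.

End ExponentialGeneratingFunction.

(** * Entrywise differentiation of matrix-valued functions *)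

Section MatrixDerivative.
Context {R : realType}.

Definition is_derive_entries {m n} (M : R -> 'M[R]_(m, n)) (M' : R -> 'M[R]_(m, n)) :=
  forall (t : R) i j, is_derive t (1 : R) (fun s => M s i j : R) (M' t i j).

Lemma is_derive_entriesB {m n} {M N M' N' : R -> 'M[R]_(m, n)} :
  is_derive_entries M M' -> is_derive_entries N N' ->
  is_derive_entries (fun t => M t - N t) (fun t => M' t - N' t).
Proof.
move=> dM dN t i j; rewrite !mxE.
have -> : (fun s => (M s - N s) i j) = (fun s => M s i j) - (fun s => N s i j).
  by apply/funext => s; rewrite !mxE.
exact: is_deriveB (dM t i j) (dN t i j).
Qed.

Lemma is_derive_entriesM {m n p} {M M' : R -> 'M[R]_(m, n)}
    {N N' : R -> 'M[R]_(n, p)} :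
  is_derive_entries M M' -> is_derive_entries N N' ->
  is_derive_entries (fun t => M t *m N t) (fun t => M' t *m N t + M t *m N' t).
Proof.
move=> dM dN t i j.
have -> : (fun s => (M s *m N s) i j) =
    \sum_(k < n) (fun s => M s i k) * (fun s => N s k j).
  by apply/funext => s; rewrite !mxE fct_sumE.
rewrite !mxE -big_split/=; apply: is_derive_sum => k.
apply: trigger_derive; first exact: is_deriveM (dM t i k) (dN t k j).
by rewrite /GRing.scale/= addrC (mulrC (N t k j)).
Qed.

Lemma is_derive_entries_cst {m n} (C : 'M[R]_(m, n)) :
  is_derive_entries (fun=> C) (fun=> 0).
Proof. by move=> t i j; rewrite mxE; exact: is_derive_cst. Qed.

Lemma is_derive_entries_eq {m n} {M M' : R -> 'M[R]_(m, n)} N :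
  M' =1 N -> is_derive_entries M M' -> is_derive_entries M N.
Proof. by move=> /funext <-. Qed.

(** This is the tool for the matrix identities below: the difference of the two sides has derivative
    zero, and it is evaluated at 0. *)
Lemma is_derive_entries0 {m n} {M : R -> 'M[R]_(m, n)} s t :
  is_derive_entries M (fun=> 0) -> M s = M t.
Proof.
move=> dM; apply/matrixP => i j.
apply: (@is_derive_0_is_cst _ (fun t => M t i j)) => u.
by have := dM u i j; rewrite mxE.
Qed.

End MatrixDerivative.

(** * The matrix exponential and its primitive as entrywise generating functions *)

Section MatrixExponential.
Context {R : realType} {d : nat}.
Implicit Types (V W : 'M[R]_d) (A : nat -> 'M[R]_d).

Definition mx_exp_bounded A := forall i j, exp_bounded (fun k => A k i j).

Definition mx_egf A (t : R) : 'M[R]_d := \matrix_(i, j) egf (fun k => A k i j) t.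

Lemma mx_egf0 A : mx_egf A 0 = A 0%N.
Proof. by apply/matrixP => i j; rewrite mxE egf0. Qed.

Lemma is_derive_mx_egf {A} : mx_exp_bounded A ->
  is_derive_entries (mx_egf A) (mx_egf (fun k => A k.+1)).
Proof.
move=> bA t i j; rewrite mxE.
have -> : (fun s => mx_egf A s i j) = egf (fun k => A k i j).
  by apply/funext => s; rewrite mxE.
exact: is_derive_egf.
Qed.

Lemma mx_egf_mull V A t : mx_exp_bounded A ->
  mx_egf (fun k => V *m A k) t = V *m mx_egf A t.
Proof.
move=> bA; apply/matrixP => i j; rewrite !mxE.
have -> : (fun k => (V *m A k) i j) = (fun k => \sum_l V i l * A k l j).
  by apply/funext => k; rewrite mxE.
rewrite (egf_sum _ (a_ := fun l k => V i l * A k l j)).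
  by apply: eq_bigr => l _; rewrite mxE egfZ//; exact: bA.
by move=> l; apply: (exp_boundedZ _ (bA l j)).
Qed.

Lemma mx_egf_trmx A t : (mx_egf A t)^T = mx_egf (fun k => (A k)^T) t.
Proof.
apply/matrixP => i j; rewrite !mxE; congr egf.
by apply/funext => k; rewrite mxE.
Qed.

Lemma mx_egf_mulr V A t : mx_exp_bounded A ->
  mx_egf (fun k => A k *m V) t = mx_egf A t *m V.
Proof.
move=> bA; apply: trmx_inj; rewrite trmx_mul !mx_egf_trmx -mx_egf_mull.
  by congr mx_egf; apply/funext => k; rewrite trmx_mul.
move=> i j; have -> : (fun k => (A k)^T i j) = (fun k => A k j i).
  by apply/funext => k; rewrite mxE.
exact: bA.
Qed.

(** The powers of V delayed by one index: the generating function is the sum of V^k t^(k+1) /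
    (k+1)!, whose derivative is exp(tV) and whose value at 0 is 0. *)
Definition phi_coef V (k : nat) : 'M[R]_d := if k is k'.+1 then V ^+ k' else 0.

Lemma exp_bounded_expmx V : mx_exp_bounded (fun k => V ^+ k).
Proof.
pose C := 1 + \sum_i \sum_j `|V i j|.
have C0 : 0 <= C by rewrite addr_ge0// sumr_ge0// => i _; exact: sumr_ge0.
move=> i j; exists 1, C; split=> // k; rewrite mul1r.
(* The row index must vary, since row i of V V^k involves all rows of V^k. *)
elim: k i => [|k IH] i.
  by rewrite !expr0 mxE; case: eqP => _; rewrite ?normr1 ?normr0.
rewrite exprS -mulmxE mxE exprS (le_trans (ler_norm_sum _ _ _))//.
apply: (@le_trans _ _ (\sum_l `|V i l| * C ^+ k)).
  by apply: ler_sum => l _; rewrite normrM ler_wpM2l.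
rewrite -mulr_suml ler_wpM2r ?exprn_ge0//.
rewrite ler_wpDl// [leRHS](bigD1 i)//= lerDl sumr_ge0// => l _; exact: sumr_ge0.
Qed.

Lemma exp_bounded_phi V : mx_exp_bounded (phi_coef V).
Proof.
move=> i j; have [B [C [C0 bV]]] := exp_bounded_expmx V i j.
have B0 : 0 <= B by have := bV 0%N; rewrite expr0 mulr1; apply: le_trans.
(* A base of at least 1 absorbs the delay by one index. *)
exists B, (1 + C); split; first exact: addr_ge0.
have CC k : C ^+ k <= (1 + C) ^+ k.
  by rewrite lerXn2r ?nnegrE ?addr_ge0// lerDr.
case=> [|k]; first by rewrite mxE normr0 expr0 mulr1.
rewrite (le_trans (bV k))// ler_wpM2l// (le_trans (CC k))// exprS.
by rewrite ler_peMl ?exprn_ge0 ?addr_ge0// lerDl.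
Qed.

(* [expmxt V t] is exp(tV), and [phimxt V t] is its primitive t phi(tV). *)
Definition expmxt V := mx_egf (fun k => V ^+ k).
Definition phimxt V := mx_egf (phi_coef V).

Lemma is_derive_expmxt V :
  is_derive_entries (expmxt V) (fun t => V *m expmxt V t).
Proof.
apply: is_derive_entries_eq (is_derive_mx_egf (exp_bounded_expmx V)) => t.
rewrite -mx_egf_mull; last exact: exp_bounded_expmx.
by congr mx_egf; apply/funext => k; rewrite exprS.
Qed.

Lemma is_derive_phimxt V : is_derive_entries (phimxt V) (expmxt V).
Proof. exact: is_derive_mx_egf (exp_bounded_phi V). Qed.

(** Both sides have derivative V exp(tV) and vanish at t = 0. *)
Lemma mul_phimxt V t : V *m phimxt V t = expmxt V t - 1%:M.
Proof.
suff : V *m phimxt V t - expmxt V t = V *m phimxt V 0 - expmxt V 0.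
  rewrite /phimxt /expmxt !mx_egf0 mulmx0 sub0r expr0 => /eqP.
  by rewrite subr_eq addrC => /eqP.
apply: (is_derive_entries0 (M := fun t => V *m phimxt V t - expmxt V t)).
apply: is_derive_entries_eq (is_derive_entriesB (is_derive_entriesM
  (is_derive_entries_cst V) (is_derive_phimxt V)) (is_derive_expmxt V)) => s.
by rewrite mul0mx add0r subrr.
Qed.

Lemma phimxtC V t : V *m phimxt V t = phimxt V t *m V.
Proof.
rewrite -mx_egf_mull; last exact: exp_bounded_phi.
rewrite -mx_egf_mulr; last exact: exp_bounded_phi.
congr mx_egf; apply/funext => -[|k] /=; rewrite ?mulmx0 ?mul0mx//.
by rewrite mulmxE -exprS -exprSr.
Qed.

Lemma phimxtN V t : phimxt V t = phimxt (- V) t *m expmxt V t.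
Proof.
suff : phimxt V t - phimxt (- V) t *m expmxt V t =
       phimxt V 0 - phimxt (- V) 0 *m expmxt V 0.
  by rewrite /phimxt !mx_egf0 mul0mx subrr => /eqP; rewrite subr_eq0 => /eqP.
apply: (is_derive_entries0 (M := fun t => phimxt V t - phimxt (- V) t *m expmxt V t)).
apply: is_derive_entries_eq (is_derive_entriesB (is_derive_phimxt V)
  (is_derive_entriesM (is_derive_phimxt (- V)) (is_derive_expmxt V))) => s.
(* This is [mul_phimxt] for -V after commuting. It turns the second term of the product rule into
   exp(sV) - exp(-sV) exp(sV), whose last product cancels the first term. *)
have GV : phimxt (- V) s *m V = 1%:M - expmxt (- V) s.
  by rewrite -[LHS]opprK -mulmxN -phimxtC mul_phimxt opprB.
rewrite mulmxA GV.
by rewrite mulmxBl mul1mx [X in _ - X]addrC subrK subrr.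
Qed.

Lemma phimxt_trmx V t : (phimxt V t)^T = phimxt V^T t.
Proof.
rewrite mx_egf_trmx; congr mx_egf; apply/funext => -[|k] /=; first by rewrite trmx0.
by elim: k => [|k IH]; rewrite ?expr0 ?trmx1// exprS -mulmxE trmx_mul IH mulmxE exprSr.
Qed.

(** The relation S V = W S passes to all powers, hence to the series. It serves to move a skew S
    across the transpose of phi(V). *)
Lemma phimxt_intertwine V W S t :
  S *m V = W *m S -> S *m phimxt V t = phimxt W t *m S.
Proof.
move=> SVW; rewrite -mx_egf_mull; last exact: exp_bounded_phi.
rewrite -mx_egf_mulr; last exact: exp_bounded_phi.
congr mx_egf; apply/funext => -[|k] /=; rewrite ?mulmx0 ?mul0mx//.
elim: k => [|k IH]; first by rewrite !expr0 mulmx1 mul1mx.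
by rewrite exprS -mulmxE mulmxA SVW -mulmxA IH mulmxA mulmxE -exprS.
Qed.

(** A matrix neighbourhood contains a product of neighbourhoods of the finitely many entries, so the
    entrywise conditions hold simultaneously. *)
Lemma cvg_entries {T : Type} {F : set_system T} {FF : Filter F} {m n}
    (M_ : T -> 'M[R]_(m, n)) (M : 'M[R]_(m, n)) :
  (forall i j, M_ t i j @[t --> F] --> M i j) -> M_ @ F --> M.
Proof.
move=> cM; move=> A [P MP PA].
have : \forall t \near F, forall i j, P i j (M_ t i j).
  by apply: filter_forall => i; apply: filter_forall => j; apply: cM; exact: MP.
by apply: filterS => t; apply: PA.
Qed.

(** Links the limit of the matrix series with the entrywise power series; the factor t^k comes out
    of (tV)^k. *)
Lemma expmx_scale V t : expmx (t *: V) = expmxt V t.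
Proof.
apply/cvg_lim; first exact: norm_hausdorff.
apply: cvg_entries => i j; rewrite mxE.
have -> : (fun n => series (fun k => k`!%:R^-1 *: (t *: V) ^+ k) n i j) =
    pseries (egf_coef (fun k => (V ^+ k) i j)) t.
  apply/funext => n; rewrite /pseries /series /= summxE; apply: eq_bigr => k _.
  rewrite mxE /egf_coef -mulrA; congr (_ * _).
  elim: k i => [|k IH] i; first by rewrite !expr0 mulr1.
  rewrite !exprS -!mulmxE !mxE mulr_suml; apply: eq_bigr => l _.
  by rewrite mxE IH; ring.
exact: is_cvg_egf (exp_bounded_expmx V i j).
Qed.

End MatrixExponential.

(** * Integrals over [0, 1]: the function phi and the gradient theorem *)

Section UnitIntervalIntegrals.
Context {R : realType}.
Let mu := @lebesgue_measure R.

Lemma Rintegral01_FTC2 (F f : R -> R) :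
  (forall t : R, is_derive t (1 : R) F (f t)) -> continuous f ->
  \int[mu]_(t in `[0, 1]) f t = F 1 - F 0.
Proof.
move=> dF cf; rewrite /Rintegral (@continuous_FTC2 _ f F)//.
- exact: continuous_subspaceT.
- have cF : continuous F.
    by move=> t; apply/differentiable_continuous/derivable1_diffP; have [] := dF t.
  split; first by move=> t _; have [] := dF t.
  + exact/cvg_at_right_filter/cF.
  + exact/cvg_at_left_filter/cF.
- by move=> t _; rewrite derive1E; have [] := dF t.
Qed.

Lemma Rintegral01_sum n (f : 'I_n -> R -> R) (c : 'I_n -> R) :
  (forall i, continuous (f i)) ->
  \int[mu]_(t in `[0, 1]) (\sum_i c i * f i t) =
  \sum_i c i * \int[mu]_(t in `[0, 1]) f i t.
Proof.
move=> cf.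
have intf i : mu.-integrable `[0, 1] (EFin \o f i).
  apply: continuous_compact_integrable; first exact: segment_compact.
  exact/continuous_subspaceT/cf.
have intcf i : mu.-integrable `[0, 1] (fun t => (c i * f i t)%:E).
  exact: integrableZl (intf i).
rewrite /Rintegral; under eq_integral do rewrite -sumEFin.
rewrite integral_sum//= -sum_fine; last by move=> i _; exact: integrable_fin_num.
by apply: eq_bigr => i _; rewrite -RintegralZl.
Qed.

(** Substituting 1 - xi for xi leaves the integral of exp(tV), whose primitive vanishes at 0. *)
Lemma phimxE {d} (V : 'M[R]_d) : phimx V = phimxt V 1.
Proof.
apply/matrixP => i j; rewrite [LHS]mxE.
under eq_Rintegral do rewrite expmx_scale.
have cE : continuous (fun t => expmxt V t i j).
  move=> t; apply/differentiable_continuous/derivable1_diffP.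
  by have [] := is_derive_expmxt V t i j.
have := @Rintegration_by_substitution_onem _ (fun t => expmxt V t i j) 1.
rewrite unstable.onem1 => <-; [|by rewrite ler01 lexx|exact: continuous_subspaceT].
have dphi (t : R) : is_derive t (1 : R) (fun s => phimxt V s i j) (expmxt V t i j).
  exact: is_derive_phimxt.
by rewrite (Rintegral01_FTC2 _ _ dphi)// [phimxt V 0]mx_egf0 [X in _ - X]mxE subr0.
Qed.

Lemma cV_sum_delta {d} (v : 'cV[R]_d) : v = \sum_i v i 0 *: delta_mx i 0.
Proof. by rewrite {1}[v]matrix_sum_delta; apply: eq_bigr => i _; rewrite big_ord1. Qed.

Lemma derive_grad {d} (f : 'cV[R]_d -> R) x v : differentiable f x ->
  'D_v f x = \sum_i v i 0 * grad f x i 0.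
Proof.
move=> df; rewrite deriveE// {1}[v]cV_sum_delta linear_sum; apply: eq_bigr => i _.
by rewrite linearZ mxE deriveE.
Qed.

(** The fundamental theorem of calculus is applied to f along the segment from x to y, with the
    directional derivative expanded in partial derivatives. *)
Lemma gradient_theorem {d} (f : 'cV[R]_d -> R) (x y : 'cV[R]_d) :
  (forall z, differentiable f z) -> continuous (grad f) ->
  f y - f x =
  ((y - x)^T *m mxint01 (fun t => grad f (t *: y + (1 - t) *: x))) 0 0.
Proof.
move=> df cgf; pose l (t : R) := t *: y + (1 - t) *: x.
have lE t : l t = x + t *: (y - x).
  by rewrite /l scalerBl scale1r scalerBr addrCA addrC.
have cl : continuous l.
  rewrite (funext lE : l = _) => t; apply: cvgD; first exact: cvg_cst.
  exact: scalel_continuous.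
have dfl (t : R) : is_derive t (1 : R) (f \o l) ('D_(y - x) f (l t)).
  (* Since l is affine with velocity y - x, the difference quotient of f along l at t is that of f
     at l(t) in direction y - x. *)
  have E : (fun h : R => h^-1 *: ((f \o l) (h *: 1 + t) - (f \o l) t)) =
      (fun h : R => h^-1 *: (f (h *: (y - x) + l t) - f (l t))).
    apply/funext => h; congr (_ *: (f _ - _)).
    by rewrite !lE scalerDl [h *: 1]mulr1 addrCA.
  by split; rewrite /derivable /derive E//; exact: diff_derivable.
have cg i : continuous (fun t => grad f (l t) i 0).
  move=> t; apply: (continuous_comp (f := grad f \o l) (g := fun M : 'cV_d => M i 0)).
    by apply: continuous_comp; [exact: cl|exact: cgf].
  exact: coord_continuous.
rewrite mxE; under eq_bigr => i _ do rewrite !mxE.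
have -> : \sum_i (y i 0 - x i 0) * \int[mu]_(t in `[0, 1]) grad f (l t) i 0 =
   \int[mu]_(t in `[0, 1]) (\sum_i (y - x) i 0 * grad f (l t) i 0).
  by rewrite Rintegral01_sum//; apply: eq_bigr => i _; rewrite !mxE.
under eq_Rintegral do rewrite -derive_grad//.
rewrite (Rintegral01_FTC2 _ _ dfl).
  by rewrite /= !lE scale0r addr0 scale1r [x + _]addrC subrK.
under eq_fun do rewrite derive_grad//.
move=> t; apply: cvg_big => [|i _]; first exact: add_continuous.
by apply: cvgM; [exact: cvg_cst|exact: cg].
Qed.

End UnitIntervalIntegrals.

(** * Energy balance of one exponential substep *)

Section EnergyBalance.
Context {R : realType} {d : nat} {S L : 'M[R]_d} (tau : R).
Hypotheses (S_skew : S^T = - S) (L_sym : L^T = L).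
Let V := tau *: (S *m L).

Lemma phimx_skew :
  let A := phimx V *m S in A + A^T + tau *: (A^T *m L *m A) = 0.
Proof.
move=> A.
have trA : A^T = - (phimxt (- V) 1 *m S).
  rewrite /A phimxE trmx_mul phimxt_trmx S_skew mulNmx; congr (- _).
  (* The required relation S V^T = -V S holds because both sides equal -tau S L S. *)
  apply: phimxt_intertwine.
  by rewrite /V linearZ/= trmx_mul S_skew L_sym mulmxN scalerN mulmxN mulNmx
    -scalemxAr -scalemxAl mulmxA.
rewrite trA !mulNmx scalerN -addrA -opprD; apply/eqP; rewrite subr_eq0; apply/eqP.
(* Regrouping tau S L as V and factoring out S on the right leaves phi(V) = phi(-V) + phi(-V) V
   phi(V). *)
rewrite /A phimxE scalemxAl -[_ *m S *m L]mulmxA scalemxAr -/V !mulmxA -mulmxDl.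
congr (_ *m _); rewrite -[_ *m V *m _]mulmxA mul_phimxt mulmxBr mulmx1 -phimxtN.
by rewrite addrC subrK.
Qed.

Lemma quadratic_energy_balance (p0 p1 g : 'cV[R]_d) :
  p1 = expmx V *m p0 + tau *: (phimx V *m S *m g) ->
  2^-1 * (p1^T *m L *m p1) 0 0 + ((p1 - p0)^T *m g) 0 0 =
  2^-1 * (p0^T *m L *m p0) 0 0.
Proof.
move=> p1E; have := phimx_skew; set A := phimx V *m S => /= skewA.
pose w := L *m p0 + g; pose D := p1 - p0.
have DE : D = tau *: (A *m w).
  have expE : expmx V = 1%:M + phimx V *m V.
    by rewrite phimxE -phimxtC mul_phimxt -expmx_scale scale1r addrC subrK.
  rewrite /D p1E expE mulmxDl mul1mx addrAC [p0 + _]addrC addrK mulmxDr scalerDr.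
  by rewrite /V -scalemxAr -scalemxAl !mulmxA.
(* With D = tau A w, this is tau times the quadratic form of the zero matrix of [phimx_skew] at
   w. *)
have Dw : D^T *m w + w^T *m D + D^T *m L *m D = 0.
  transitivity (tau *: (w^T *m (A + A^T + tau *: (A^T *m L *m A)) *m w)).
    rewrite DE; generalize A w => B v; rewrite linearZ/= trmx_mul.
    rewrite !mulmxDr !mulmxDl -!scalemxAl -!scalemxAr !scalerDr -!scalemxAl.
    by rewrite !mulmxA [X in X + _ = _]addrC.
  by rewrite skewA mulmx0 mul0mx scaler0.
have gD : (g^T *m D) 0 0 = (D^T *m g) 0 0.
  by rewrite -[in RHS](trmxK g) -trmx_mul [RHS]mxE.
have p1D : p1 = p0 + D by rewrite /D addrC subrK.
clearbody D; rewrite p1D [p0 + D]addrC addrK.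
move: Dw => /matrixP /(_ 0 0).
rewrite /w [(_ + g)^T]linearD/= trmx_mul L_sym [(D + p0)^T]linearD/=.
rewrite !(mulmxDl, mulmxDr) !mulmxA.
have addE (M N : 'M[R]_1) : (M + N) 0 0 = M 0 0 + N 0 0 by rewrite mxE.
rewrite !addE gD [X in _ = X]mxE => Dw0.
(* Expanding w = L p0 + g in [Dw] gives twice the claimed balance. *)
lra.
Qed.

(** The work of the averaged gradient appears in the quadratic balance and in the gradient theorem
    with opposite signs, and cancels. *)
Lemma substep_energy (f : 'cV[R]_d -> R) (p0 p1 : 'cV[R]_d) :
  (forall p, differentiable f p) -> continuous (grad f) ->
  p1 = expmx V *m p0 + tau *: (phimx V *m S *m
         mxint01 (fun xi => grad f (xi *: p1 + (1 - xi) *: p0))) ->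
  2^-1 * (p1^T *m L *m p1) 0 0 + f p1 = 2^-1 * (p0^T *m L *m p0) 0 0 + f p0.
Proof.
move=> df cgf p1E.
have cancel_work (a b u v x : R) : a + x = b -> u - v = x -> a + u = b + v.
  by move=> <- <-; ring.
exact: cancel_work (quadratic_energy_balance _ _ _ p1E)
                   (gradient_theorem f p0 p1 df cgf).
Qed.

End EnergyBalance.

(** * Regularity of U with one variable frozen *)

Section PartialGradients.
Context {R : realType} {d : nat} {U : 'cV[R]_d * 'cV[R]_d -> R}.
Hypothesis U_C1 : continuously_differentiable U.

Lemma differentiable_pairl (q p : 'cV[R]_d) :
  differentiable (fun p : 'cV[R]_d => (p, q)) p.
Proof. exact: (@differentiable_pair _ _ _ _ id (cst q) p). Qed.

Lemma differentiable_pairr (p q : 'cV[R]_d) :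
  differentiable (fun q : 'cV[R]_d => (p, q)) q.
Proof. exact: (@differentiable_pair _ _ _ _ (cst p) id q). Qed.

Lemma differentiable_l q p : differentiable (fun p => U (p, q)) p.
Proof.
have [dU _ _] := U_C1.
exact: differentiable_comp (differentiable_pairl q p) (dU (p, q)).
Qed.

Lemma differentiable_r p q : differentiable (fun q => U (p, q)) q.
Proof.
have [dU _ _] := U_C1.
exact: differentiable_comp (differentiable_pairr p q) (dU (p, q)).
Qed.

Lemma continuous_gradp q : continuous (grad (fun p => U (p, q))).
Proof.
have [_ cU _] := U_C1 => p.
exact: continuous_comp (differentiable_continuous (differentiable_pairl q p))
  (cU (p, q)).
Qed.

Lemma continuous_gradq p : continuous (grad (fun q => U (p, q))).
Proof.
have [_ _ cU] := U_C1 => q.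
exact: continuous_comp (differentiable_continuous (differentiable_pairr p q))
  (cU (p, q)).
Qed.

End PartialGradients.

Theorem theorem3p1 (R : realType) (d : nat) (S1 S2 L1 L2 : 'M[R]_d)
    (U : 'cV[R]_d * 'cV[R]_d -> R) (tau : R)
    (S1_skew : S1^T = - S1) (S2_skew : S2^T = - S2)
    (L1_sym : L1^T = L1) (L2_sym : L2^T = L2)
    (U_C1 : continuously_differentiable U) (tau_gt0 : 0 < tau)
    (p0 q0 p1 q1 : 'cV[R]_d) :
  (EPAVF_step S1 S2 L1 L2 U tau p0 q0 p1 q1 ->
     hamiltonian L1 L2 U p1 q1 = hamiltonian L1 L2 U p0 q0) /\
  (EPAVF_adjoint_step S1 S2 L1 L2 U tau p0 q0 p1 q1 ->
     hamiltonian L1 L2 U p1 q1 = hamiltonian L1 L2 U p0 q0).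
Proof.
have substep_p q := substep_energy tau S1_skew L1_sym _ p0 p1
  (differentiable_l U_C1 q) (continuous_gradp U_C1 q).
have substep_q p := substep_energy tau S2_skew L2_sym _ q0 q1
  (differentiable_r U_C1 p) (continuous_gradq U_C1 p).
(* Here v is the value of U at the intermediate point: (p1, q0) for the method and (p0, q1) for its
   adjoint. *)
have telescope (a a' b b' u v w : R) :
  a + v = a' + w -> b + u = b' + v -> a + b + u = a' + b' + w.
  by move=> av bu; rewrite -addrA bu addrCA av addrCA addrA.
split=> -[pE qE].
  exact: telescope (substep_p q0 pE) (substep_q p1 qE).
(* For the adjoint the energies telescope with the q-substep first, so the two quadratic terms are
   swapped. *)
rewrite /hamiltonian [X in X + _]addrC [X in _ = X + _]addrC.
exact: telescope (substep_q p0 qE) (substep_p q1 pE).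
Qed.
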